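(* Let $G$ be a finite simple connected graph. Each maximal clique of $Aux(G)$ on three or more vertices arises from exactly one of the following: a cycle of $G$ or a minimal edge cut of $G$; and its size is the length of the cycle, respectively the number of edges in the edge cut. Precisely: (1) If $C$ is a cycle of length $k$ in $G$, $T$ is a spanning tree of $G$ using $k-1$ edges of $C$, and $F$ is the forest obtained from $T$ by deleting these $k-1$ edges, then the $k$ spanning trees obtained by adding to $F$ any $k-1$ of the edges of $C$ form a maximal clique of size $k$ in $Aux(G)$. (2) If $\mathcal{E}$ is a minimal edge cut of $G$ with $k\ge 3$ edges, and $T_1,T_2$ are spanning trees of the two components of $G-\mathcal{E}$, then the $k$ spanning trees obtained by joining $T_1$ and $T_2$ with any one edge of $\mathcal{E}$ form a maximal clique of size $k$ in $Aux(G)$. (3) Every maximal clique of $Aux(G)$ with at least three vertices is of the form described in (1) or of the form described in (2), and not both.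
   Context: For a finite simple connected graph $G$ on $n$ vertices, the spanning tree auxiliary graph $Aux(G)$ is the graph whose vertices are the spanning trees of $G$, two spanning trees being adjacent if and only if one is obtained from the other by a single unit transformation, i.e. by adding one edge of $G$ not in the tree and deleting a different edge so that the result is again a spanning tree; equivalently, the symmetric difference of their edge sets has exactly two edges (they share exactly $n-2$ of their $n-1$ edges). A clique is a set of pairwise adjacent vertices; it is maximal if it is not properly contained in another clique. A minimal edge cut is an inclusion-minimal set of edges whose removal disconnects $G$. *)

(* Defs.v *)
From mathcomp Require Import all_boot.

Set Implicit Arguments.
Unset Strict Implicit.
Unset Printing Implicit Defensive.

(* A finite simple graph is a symmetric irreflexive relation e on a finType;
   its edges, and those of its subgraphs, are unordered pairs [set x; y].   *)

Section Graphs.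

Variable V : finType.
Implicit Types (e r : rel V) (c : seq V) (A B : {set V}).
Implicit Types (F S C D K : {set {set V}}) (Q : {set {set {set V}}}).

Definition edges e : {set {set V}} :=
  [set [set p.1; p.2] | p : V * V & e p.1 p.2].

Definition edge_rel F : rel V := [rel x y | [set x; y] \in F].

Definition is_cycle r c : bool := (2 < size c) && ucycleb r c.

(* The length of c as a cycle is size c. *)
Definition cycle_edges c : {set {set V}} := [set [set x; next c x] | x in c].

Definition connected_on A F : bool :=
  [forall x in A, forall y in A, connect (edge_rel F) x y].

(* The bound on the length is harmless since the vertices of a cycle are
   distinct; see acyclicP. *)
Definition acyclic F : bool :=
  [forall n : 'I_#|V|.+1, forall c : n.-tuple V, ~~ is_cycle (edge_rel F) c].

Lemma acyclicP F :
  reflect (forall c, ~~ is_cycle (edge_rel F) c) (acyclic F).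
Proof.
apply: (iffP forallP) => [acF c | acF n]; last by apply/forallP => c.
apply/negP => cyc; have /andP[_ /andP[_ Uc]] := cyc.
have ltc : size c < #|V|.+1 by rewrite ltnS -(card_uniqP Uc) max_card.
by have /forallP/(_ (in_tuple c)) := acF (Ordinal ltc); rewrite cyc.
Qed.

(* S is a spanning tree of the graph with vertex set A and edge set F, where
   every edge in F is a subset of A. *)
Definition spanning_tree A F S : bool :=
  [&& S \subset F, connected_on A S & acyclic S].

Definition graph_tree e S : bool := spanning_tree [set: V] (edges e) S.

(* Adjacency in Aux(G): S' is S with an edge f of G outside S added and
   another edge g deleted. *)
Definition aux_adj e S S' : bool :=
  [&& graph_tree e S, graph_tree e S' &
      [exists f in edges e :\: S, exists g in S, S' == (f |: S) :\ g]].

Definition aux_clique e Q : bool :=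
  [forall S in Q, graph_tree e S] &&
  [forall S in Q, forall S' in Q, (S != S') ==> aux_adj e S S'].

Definition max_aux_clique e Q : bool := maxset (aux_clique e) Q.

Definition edge_cut e K : bool :=
  (K \subset edges e) && ~~ connected_on [set: V] (edges e :\: K).

Definition min_edge_cut e K : bool := minset (edge_cut e) K.

(* Vertex sets of the connected components of the graph on V with edge set F. *)
Definition components F : {set {set V}} :=
  equivalence_partition (connect (edge_rel F)) [set: V].

(* F ::&: A is the set of the edges in F with both ends in A. *)
Definition component_tree F A S : bool := spanning_tree A (F ::&: A) S.

Definition cycle_data e c S : Prop :=
  [/\ is_cycle e c, graph_tree e S
    & #|S :&: cycle_edges c| = (size c).-1].

Definition cycle_family c S : {set {set {set V}}} :=
  [set (S :\: cycle_edges c) :|: D | D : {set {set V}} &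
     (D \subset cycle_edges c) && (#|D| == (size c).-1)].

Definition cut_data e K A B S1 S2 : Prop :=
  [/\ min_edge_cut e K /\ 3 <= #|K|,
      [/\ A \in components (edges e :\: K), B \in components (edges e :\: K)
        & A != B],
      component_tree (edges e :\: K) A S1
    & component_tree (edges e :\: K) B S2].

Definition cut_family K S1 S2 : {set {set {set V}}} :=
  [set f |: (S1 :|: S2) | f in K].

Definition cycle_form e Q : Prop :=
  exists c S, cycle_data e c S /\ Q = cycle_family c S.

Definition cut_form e Q : Prop :=
  exists K A B S1 S2, cut_data e K A B S1 S2 /\ Q = cut_family K S1 S2.

Lemma edge_rel_edges e : symmetric e -> edge_rel (edges e) =2 e.
Proof.
move=> sym_e x y; apply/imsetP/idP => [[[a b]] | exy]; first last.
  by exists (x, y); rewrite ?inE.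
rewrite inE /= => eab eq_xy.
have [ax bx] : a \in [set x; y] /\ b \in [set x; y].
  by rewrite eq_xy !inE !eqxx orbT.
have [xa ya] : x \in [set a; b] /\ y \in [set a; b].
  by rewrite -eq_xy !inE !eqxx orbT.
move: ax bx xa ya; rewrite !inE.
by do 4![case/orP=> /eqP ?]; subst; first [done | by rewrite sym_e].
Qed.

End Graphs.

(* Main.v *)
Require Import Defs.
From mathcomp Require Import all_boot.

Set Implicit Arguments.
Unset Strict Implicit.
Unset Printing Implicit Defensive.

(** Only two shapes are possible for a family of equicardinal sets any two of
    which differ by one exchange: either all members arise from one set U by
    deleting an element, or all arise from one set N by adding an element
    (exchange_clique_types), and three members cannot have both shapes
    (exchange_types_exclusive).  The set U, respectively N, is determined by any
    two members, so the family of all spanning trees U :\ g with g in U, or of all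
    spanning trees f |: N with f outside N, is a maximal clique as soon as it has
    three members (remove_max, add_max), and every maximal clique of three or
    more trees is such a family.

    It remains to recognize the possible g and f.  Spanning trees are treated as
    the edge sets that are minimal among the connected ones (graph_treeP), and a
    connected exchange in a tree is again minimal (tree_exchange), so that no edge
    is ever counted.  If U contains a tree U :\ g0, then U :\ g is a tree exactly
    when g is on the cycle of U (cycle_trees).  If N together with an edge is a
    tree, N is a forest with two components, and f |: N is a tree exactly when f
    runs between them; these edges f form a minimal cut (cut_of_trees), and
    conversely every minimal cut with trees on its two sides arises in this way
    (cut_trees).                                                               *)

(** * Connectivity of edge sets *)

Section Connectivity.

Variable V : finType.
Implicit Types (x y z u v : V) (e : rel V) (A B : {set V}) (f g h : {set V}).
Implicit Types (F N S T U K : {set {set V}}).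

Local Notation linked F := (connect (edge_rel F)).
Local Notation connected F := (connected_on [set: V] F).

Lemma set2_inj x y u v :
  [set x; y] = [set u; v] -> x = u /\ y = v \/ x = v /\ y = u.
Proof.
move=> eq_xy; have [xu yu] : x \in [set u; v] /\ y \in [set u; v].
  by rewrite -eq_xy set21 set22.
have [ux vx] : u \in [set x; y] /\ v \in [set x; y].
  by rewrite eq_xy set21 set22.
move: xu yu ux vx; rewrite !inE.
by do 4![case/orP=> /eqP ?]; subst; auto.
Qed.

Lemma linked_sym F : connect_sym (edge_rel F).
Proof. by apply: sym_connect_sym => x y; rewrite /edge_rel /= setUC. Qed.

Lemma linkedS F F' x y : F \subset F' -> linked F x y -> linked F' x y.
Proof.
move=> sFF'; apply: connect_sub => {}x {}y xy.
by apply: connect1; apply: (subsetP sFF').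
Qed.

Lemma linked_edge F x y : [set x; y] \in F -> linked F x y.
Proof. by move=> Fxy; apply: connect1. Qed.

(** A walk through the new edge splits at its first and last use of it. *)
Lemma linkedU1 F x y u v :
  linked ([set x; y] |: F) u v =
    [|| linked F u v, linked F u x && linked F y v | linked F u y && linked F x v].
Proof.
set F' := _ |: F; have sFF' : F \subset F' by apply: subsetUr.
have Fxy : linked F' x y by rewrite linked_edge ?setU11.
apply/idP/or3P=> [/connectP[p]|]; last first.
  have lift a b := @linkedS F F' a b sFF'.
  case=> [/lift//|/andP[/lift ux /lift yv]|/andP[/lift uy /lift xv]].
    exact: connect_trans ux (connect_trans Fxy yv).
  by apply: connect_trans uy (connect_trans _ xv); rewrite linked_sym.
elim: p u => [|w p IHp] u /=; first by move=> _ ->; constructor 1.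
case/andP=> uw /IHp{}IHp /IHp{IHp}.
have {uw}: [set u; w] \in F' by []; rewrite in_setU1 => /orP[/eqP/set2_inj|Fuw].
  case=> [] [-> ->] [yv|/andP[_ yv]|/andP[_ xv]];
    by [constructor 1 | constructor 2; rewrite connect0
       | constructor 3; rewrite connect0].
have uw := linked_edge Fuw.
case=> [wv|/andP[wx yv]|/andP[wy xv]].
- by constructor 1; apply: connect_trans wv.
- by constructor 2; rewrite yv (connect_trans uw wx).
by constructor 3; rewrite xv (connect_trans uw wy).
Qed.

Lemma linkedU1_id F x y : linked F x y -> linked ([set x; y] |: F) =2 linked F.
Proof.
move=> xy u v; rewrite linkedU1; apply/or3P/idP=> [|uv]; last by constructor 1.
case=> [//|/andP[ux yv]|/andP[uy xv]].
  exact: connect_trans ux (connect_trans xy yv).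
by apply: connect_trans uy (connect_trans _ xv); rewrite linked_sym.
Qed.

Lemma connectedP F : reflect (forall x y, linked F x y) (connected F).
Proof.
apply: (iffP forall_inP) => [cF x y | cF x _]; last by apply/forall_inP.
by have /forall_inP := cF x (in_setT x); apply.
Qed.

Lemma connectedS F F' : F \subset F' -> connected F -> connected F'.
Proof. by move=> sF /connectedP cF; apply/connectedP=> x y; apply: linkedS (cF x y). Qed.

(** A walk never leaves a vertex set that no edge leaves. *)
Lemma linked_within F A x y :
  closed (edge_rel F) A -> x \in A -> linked F x y -> linked (F ::&: A) x y.
Proof.
move=> clA + /connectP[p].
elim: p x => [|z p IHp] x /= Ax; first by move=> _ ->.
case/andP=> Fxz Fp Dy; have Az : z \in A by rewrite -(clA x z).
apply: connect_trans (IHp z Az Fp Dy); apply: linked_edge.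
by rewrite inE (Fxz : [set x; z] \in F); apply/subsetP=> w; rewrite !inE => /orP[]/eqP->.
Qed.

Lemma edgesP e f : reflect (exists x y, e x y /\ f = [set x; y]) (f \in edges e).
Proof.
apply: (iffP imsetP) => [[[x y] /= exy ->] | [x [y [exy ->]]]].
  by exists x, y; rewrite inE in exy.
by exists (x, y); rewrite ?inE.
Qed.

(** * Cycles *)

Lemma mem_cycle_edges x (c : seq V) : x \in c -> [set x; next c x] \in cycle_edges c.
Proof. by move=> cx; apply: imset_f. Qed.

Lemma is_cycleE F (c : seq V) :
  is_cycle (edge_rel F) c = [&& 2 < size c, uniq c & cycle_edges c \subset F].
Proof.
rewrite /is_cycle /ucycleb; case: (2 < size c) => //=.
case Uc: (uniq c); rewrite ?andbF ?andbT //=.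
apply/idP/subsetP=> [cF _ /imsetP[x cx ->] | sF].
  exact: (next_cycle cF cx).
by apply: cycle_from_next => // x cx; apply: sF; apply: mem_cycle_edges.
Qed.

Lemma is_cycle_graph e (c : seq V) : symmetric e ->
  is_cycle e c = [&& 2 < size c, uniq c & cycle_edges c \subset edges e].
Proof.
move=> e_sym; rewrite -is_cycleE /is_cycle /ucycleb.
by rewrite (eq_cycle (edge_rel_edges e_sym)).
Qed.

(** Following a cycle two steps never returns to the start, as it has at least
    three vertices; so its edges are distinct.                                 *)
Lemma cycle_edge_inj (c : seq V) : 2 < size c -> uniq c ->
  {in c &, injective (fun x => [set x; next c x])}.
Proof.
move=> szc Uc x y cx cy /set2_inj[[]//|[Dx]].
rewrite Dx => Dy; case: (rot_to cy) => i q Dc.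
have := Uc; have := szc; rewrite -(rot_uniq i) -(size_rot i).
move: Dy; rewrite -!(next_rot i Uc) Dc.
case: q {Dc Dx} => [|z [|t q]] //=; rewrite !inE eqxx.
case: (z =P y) => [-> _ _ | _]; first by rewrite eqxx.
by rewrite eqxx => ->; rewrite eqxx !orbT.
Qed.

Lemma card_cycle_edges (c : seq V) :
  2 < size c -> uniq c -> #|cycle_edges c| = size c.
Proof.
move=> szc Uc; rewrite -(card_uniqP Uc) card_in_imset //.
exact: cycle_edge_inj.
Qed.

(** Going the other way round the cycle avoids the edge at issue. *)
Lemma cycle_bypass F (c : seq V) x :
    2 < size c -> uniq c -> cycle_edges c \subset F -> x \in c ->
  linked (F :\ [set x; next c x]) (next c x) x.
Proof.
move=> szc Uc sF cx; set F' := F :\ _.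
have step z : z \in c -> z != x -> edge_rel F' z (next c z).
  move=> cz zx; rewrite /edge_rel /= in_setD1 (subsetP sF) ?mem_cycle_edges // andbT.
  by apply: contraNneq zx => /(cycle_edge_inj szc Uc cz cx) ->.
have walk p y : {subset y :: p <= c} -> x \notin y :: p ->
  fpath (next c) y (rcons p x) -> linked F' y x.
- elim: p y => [|z p IHp] y pc.
    rewrite inE /= andbT => xy /eqP Dx; rewrite -[X in linked _ _ X]Dx.
    by apply: connect1; apply: step; rewrite ?pc ?mem_head // eq_sym.
  rewrite inE negb_or => /andP[xy xp] /= /andP[/eqP Dz np].
  apply: connect_trans (IHp z _ xp np) => [|w pw]; last by rewrite pc // inE pw orbT.
  by rewrite -Dz; apply: connect1; apply: step; rewrite ?pc ?mem_head // eq_sym.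
have [i q Dc] := rot_to cx; have := cycle_next Uc.
rewrite -(rot_cycle i) Dc /=.
have qc z : z \in q -> z \in c by move=> qz; rewrite -(mem_rot i) Dc inE qz orbT.
have : uniq (x :: q) by rewrite -Dc rot_uniq.
have : 1 < size (x :: q) by rewrite -Dc size_rot ltnW.
case: q qc {Dc} => [|y q] //= qc _ /andP[xq _] /andP[/eqP Dy nq].
by rewrite Dy; apply: walk nq.
Qed.


Lemma next_neq (c : seq V) x : 2 < size c -> uniq c -> x \in c -> x != next c x.
Proof.
move=> szc Uc cx; have [i q Dc] := rot_to cx.
have := Uc; have := szc; rewrite -(rot_uniq i) -(size_rot i) -(next_rot i Uc) Dc.
by case: q {Dc} => [|y q] //=; rewrite eqxx inE negb_or => _ /andP[/andP[]].
Qed.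

Lemma acyclicS F F' : F \subset F' -> acyclic F' -> acyclic F.
Proof.
move=> sFF' /acyclicP acF'; apply/acyclicP=> c; apply: contra (acF' c).
by rewrite !is_cycleE => /and3P[-> -> /subset_trans->].
Qed.

(** * Trees as minimal connected edge sets *)

(** A shortest walk joining the ends of an edge without using it closes up with
    the edge to a cycle; conversely the rest of a cycle bypasses each edge.   *)
Lemma acyclic_bridgeP F :
  reflect (forall x y, x != y -> [set x; y] \in F -> ~~ linked (F :\ [set x; y]) x y)
          (acyclic F).
Proof.
apply: (iffP (acyclicP F)) => [acF x y xy Fxy | bridge c].
  apply/negP=> /connectP[p0 /shortenP[p Fp Up _] Dy] {p0}.
  have /negP[] := acF (x :: p); rewrite /is_cycle /ucycleb Up andbT /=.
  rewrite rcons_path -Dy; apply/and3P; split.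
  - case: p Fp Dy {Up} => [|z [|t p]] //= Fp Dy; first by rewrite Dy eqxx in xy.
    by move: Fp; rewrite -Dy andbT /edge_rel /= setD11.
  - by apply: sub_path Fp => u v; rewrite /edge_rel /= in_setD1 => /andP[].
  by rewrite /edge_rel /= setUC.
apply/negP; rewrite is_cycleE => /and3P[szc Uc sF].
case Dc: {1}c => [|x q]; first by rewrite Dc in szc.
have cx : x \in c by rewrite Dc mem_head.
have /negP[] := bridge x (next c x) (next_neq szc Uc cx)
                    (subsetP sF _ (mem_cycle_edges cx)).
by rewrite linked_sym cycle_bypass.
Qed.

Lemma connectedD1 F x y : linked (F :\ [set x; y]) x y -> connected F ->
  connected (F :\ [set x; y]).
Proof.
move=> xy /connectedP cF; apply/connectedP=> u v.
rewrite -(linkedU1_id xy); apply: linkedS (cF u v).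
by apply/subsetP=> f Ff; rewrite !inE Ff andbT orbN.
Qed.

Section SpanningTrees.

Variable e : rel V.
Hypotheses (e_sym : symmetric e) (e_irr : irreflexive e).

Lemma edge_neq x y : [set x; y] \in edges e -> x != y.
Proof.
have := edge_rel_edges e_sym x y; rewrite /edge_rel /= => -> exy.
by apply: contraTneq exy => ->; rewrite e_irr.
Qed.

(** This description is stable under exchanges without any appeal to the number
    of edges of a tree.                                                       *)
Lemma graph_treeP S :
  reflect [/\ S \subset edges e, connected S & forall g, g \in S -> ~~ connected (S :\ g)]
          (graph_tree e S).
Proof.
apply: (iffP and3P) => [[sS cS /acyclic_bridgeP acS] | [sS cS minS]]; split=> //.
  move=> g Sg; have /edgesP[x [y [_ Dg]]] := subsetP sS g Sg.
  rewrite {g}Dg in Sg *; apply: contra (acS x y _ Sg) => [/connectedP//|].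
  exact: edge_neq (subsetP sS _ Sg).
apply/acyclic_bridgeP=> x y _ Sxy; apply: contra (minS _ Sxy) => xy.
exact: connectedD1.
Qed.

(** The edge xy leaves N with at most two pieces to join, so any edge uv between
    different pieces would connect everything as well.                        *)
Lemma linked_sides N x y u v :
  connected ([set x; y] |: N) -> ~~ connected ([set u; v] |: N) -> linked N u v.
Proof.
move=> /connectedP cN; apply: contraR => uv.
set M := _ |: N; have sNM : N \subset M by apply: subsetUr.
have Muv : linked M u v by rewrite linked_edge ?setU11.
have lift a b := @linkedS N M a b sNM.
have Mxy : linked M x y.
  have := cN u v; rewrite linkedU1 (negPf uv) /=.
  case/orP=> /andP[/lift + /lift].
    rewrite linked_sym => xu; rewrite linked_sym => vy.
    exact: connect_trans xu (connect_trans Muv vy).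
  rewrite linked_sym => yu xv; rewrite linked_sym.
  by apply: connect_trans yu (connect_trans Muv _); rewrite linked_sym.
apply/connectedP=> a b; rewrite -(linkedU1_id Mxy).
by apply: linkedS (cN a b); apply: setUS.
Qed.

(** If an edge h other than f could be dropped after the exchange, then S without
    g and h would fall into two pieces joined by f.  By minimality of S neither g
    nor h alone joins them, so both run inside a piece (linked_sides), and S could
    not be connected.                                                         *)
Lemma tree_exchange S f g : graph_tree e S -> f \in edges e -> g \in S ->
  connected (f |: (S :\ g)) -> graph_tree e (f |: (S :\ g)).
Proof.
case/graph_treeP=> sS cS minS Ef Sg cSfg; apply/graph_treeP; split=> //.
  by rewrite subUset sub1set Ef (subset_trans _ sS) ?subsetDl.
move=> h; rewrite in_setU1; apply: contraTN => cSfgh; have ncSg := minS g Sg.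
(* Dropping f leaves S without g, which is disconnected. *)
have [Dh | hf] := eqVneq h f.
  apply: contra ncSg => _; apply: connectedS cSfgh; apply/subsetP=> k.
  by rewrite Dh !inE => /andP[/negPf->].
rewrite /=; apply/negP=> /setD1P[hg Sh].
set N := S :\ g :\ h.
have DSg : S :\ g = h |: N by rewrite setD1K // in_setD1 hg.
have DSh : S :\ h = g |: N.
  have ->: N = S :\ h :\ g by apply/setP=> k; rewrite !inE andbCA.
  by rewrite setD1K // in_setD1 eq_sym hg.
have{cSfgh} cNf : connected (f |: N).
  apply: connectedS cSfgh; rewrite DSg; apply/subsetP=> k.
  by rewrite !inE; case: (k =P h) => //= _; rewrite ?orbF.
have [x [y [_ Df]]] := edgesP _ _ Ef; rewrite {}Df in cNf.
have [ug [vg [_ Dg]]] := edgesP _ _ (subsetP sS g Sg).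
have [uh [vh [_ Dh]]] := edgesP _ _ (subsetP sS h Sh).
have ng : linked N ug vg by apply: (linked_sides cNf); rewrite -Dg -DSh minS.
have nh : linked N uh vh by apply: (linked_sides cNf); rewrite -Dh -DSg.
case/negP: ncSg; rewrite DSg; apply/connectedP=> a b.
have /connectedP/(_ a b) := cS.
rewrite -(setD1K Sg) DSg setUCA {1}Dh Dg.
rewrite linkedU1_id; last by apply: linkedS nh; apply: subsetUr.
rewrite linkedU1_id //; apply: linkedS; apply: subsetUr.
Qed.

(** * Deleting an edge from a tree with one more edge *)

(** A spanning tree inside U misses an edge of every cycle of U; conversely an
    edge of a cycle may be dropped without losing connectivity.               *)
Lemma cycle_trees U (c : seq V) g0 :
    U \subset edges e -> is_cycle (edge_rel U) c -> g0 \in U -> graph_tree e (U :\ g0) ->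
  forall g, g \in U -> graph_tree e (U :\ g) = (g \in cycle_edges c).
Proof.
rewrite is_cycleE => sU /and3P[szc Uc cU] Ug0 tU g Ug; apply/idP/idP.
  case/and3P=> _ _ /acyclicP/(_ c); apply: contraR => cg.
  rewrite is_cycleE szc Uc; apply/subsetP=> h ch; rewrite in_setD1 (subsetP cU) // andbT.
  by apply: contraNneq cg => <-.
move=> cg; have [<- // | gg0] := eqVneq g0 g.
have DU : g0 |: (U :\ g0 :\ g) = U :\ g.
  apply/setP=> h; rewrite !inE; case: eqP => [->|] //=.
  by rewrite gg0 Ug0.
rewrite -DU; apply: tree_exchange => //; first exact: (subsetP sU).
  by rewrite in_setD1 eq_sym gg0.
rewrite DU; have [_ cU0 _] := graph_treeP _ tU.
have {}cU0 := connectedS (subsetDl _ _) cU0.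
case/imsetP: cg => x cx ->; apply: connectedD1 => //.
by rewrite linked_sym cycle_bypass.
Qed.

(** * Trees through a forest with two components *)

Lemma componentsP F A :
  reflect (exists a, A = [set y | linked F a y]) (A \in components F).
Proof.
apply: (iffP imsetP) => [[a _ ->] | [a ->]]; exists a => //;
  by apply/setP=> y; rewrite !inE.
Qed.

Lemma component_closed F N a :
  N \subset F -> closed (edge_rel N) [set y | linked F a y].
Proof.
move=> sNF x y Nxy; rewrite !inE; apply: (same_connect_r (linked_sym F)).
exact: linkedS sNF (connect1 Nxy).
Qed.

(** By minimality of K, putting one edge xy of K back connects the graph, so A and
    B, with x and y on either side, are the only components of the rest.  Then
    xy and the trees of A and B make up a tree: a simple walk that bypasses an
    edge of the tree of A has to stay in A, since it cannot cross xy and return. *)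
Lemma cut_trees K A B S1 S2 : cut_data e K A B S1 S2 -> let N := S1 :|: S2 in
  K \subset edges e :\: N /\
  {in edges e :\: N, forall f, graph_tree e (f |: N) = (f \in K)}.
Proof.
case=> [[/minsetP[/andP[sK ncE minK] _] [/componentsP[a DA] /componentsP[b DB] AB]]].
case/and3P=> sS1 cS1 aS1 /and3P[sS2 cS2 aS2] N.
set E' := edges e :\: K in ncE DA DB sS1 sS2.
have nab : ~~ linked E' a b.
  apply: contraNN AB => ab; rewrite DA DB; apply/eqP/setP=> z; rewrite !inE.
  exact: same_connect (linked_sym E') _ _ ab z.
have sS h S C : S \subset E' ::&: C -> h \in S -> h \in E' /\ h \subset C.
  by move=> sSC /(subsetP sSC); rewrite inE => /andP[].
have sNE : N \subset E'.
  by apply/subsetP=> h; rewrite in_setU => /orP[/(sS _ _ _ sS1)[] | /(sS _ _ _ sS2)[]].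
have sNe : N \subset edges e by apply: subset_trans sNE (subsetDl _ _).
split=> //.
  apply/subsetP=> f Kf; rewrite in_setD (subsetP sK) // andbT.
  by apply: contraL Kf => /(subsetP sNE); rewrite in_setD => /andP[].
move=> f; rewrite in_setD => /andP[Nf Ef]; apply/idP/idP=> [/graph_treeP[_ cfN _] | Kf].
  apply: contraR ncE => Kf; apply: connectedS cfN; rewrite subUset sNE sub1set.
  by rewrite in_setD Kf Ef.
have cf : connected (f |: E').
  apply/negPn/negP=> ncf; have /setP/(_ f) : K :\ f = K; last by rewrite !inE eqxx Kf.
  apply: minK; last exact: subsetDl.
  rewrite /edge_cut (subset_trans (subsetDl _ _) sK); apply: contra ncf.
  apply: connectedS; apply/subsetP=> h; rewrite !inE negb_and negbK.
  by case: (h == f).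
(* The walk from a to b through f decides which end of f is on the side of a. *)
have [x [y [Df ax b_y]]] : exists x y, [/\ f = [set x; y], linked E' a x & linked E' b y].
  have [x [y [_ Df]]] := edgesP _ _ Ef.
  have /connectedP/(_ a b) := cf; rewrite Df linkedU1 (negPf nab) /=.
  case/orP=> /andP[ax]; rewrite linked_sym => by_; first by exists x, y.
  by exists y, x; split=> //; rewrite setUC.
have side z : linked E' a z \/ linked E' b z.
  have /connectedP/(_ a z) := cf; rewrite Df linkedU1.
  case/or3P=> [|/andP[_ yz]|/andP[_ xz]]; first by left.
    by right; apply: connect_trans b_y yz.
  by left; apply: connect_trans ax xz.
have cN1 z : linked E' a z -> linked N x z.
  move=> az; apply: (linkedS (subsetUl _ _)).
  by have /forall_inP/(_ x)/(_ _)/forall_inP := cS1; apply; rewrite DA inE.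
have cN2 z : linked E' b z -> linked N y z.
  move=> bz; apply: (linkedS (subsetUr _ _)).
  by have /forall_inP/(_ y)/(_ _)/forall_inP := cS2; apply; rewrite DB inE.
(* The two sides are treated alike: C is the class of d, which is a or b, and S
   is the tree of that side. *)
have bridge C d S p q : C = [set z | linked E' d z] -> acyclic S ->
    {in N, forall h, h \subset C -> h \in S} -> ~~ (linked E' d x && linked E' d y) ->
    [set p; q] \in S -> [set p; q] \in E' -> [set p; q] \subset C ->
  ~~ linked (f |: N :\ [set p; q]) p q.
- move=> DC /acyclic_bridgeP aS NC ndxy Spq Epq /subsetP sC.
  have [Cp Cq] : p \in C /\ q \in C by rewrite !sC ?set21 ?set22.
  have sN' : N :\ [set p; q] \subset E' by apply: subset_trans (subsetDl _ _) sNE.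
  have pq := edge_neq (subsetP (subsetDl _ _) _ Epq).
  rewrite Df linkedU1; apply/negP=> Lpq.
  move: Cp Cq; rewrite DC !inE => dp dq.
  case/or3P: Lpq => [pqN | /andP[px yq] | /andP[py xq]].
  + have /negP[] := aS p q pq Spq.
    have Cp : p \in C by rewrite DC inE.
    have clC : closed (edge_rel (N :\ [set p; q])) C by rewrite DC; apply: component_closed.
    apply: linkedS (linked_within clC Cp pqN); apply/subsetP=> h.
    by rewrite !inE -andbA => /and3P[-> Nh hC]; rewrite NC ?in_setU.
  + case/negP: ndxy; rewrite (connect_trans dp (linkedS sN' px)) /=.
    by apply: connect_trans dq _; rewrite linked_sym (linkedS sN' yq).
  case/negP: ndxy; rewrite (connect_trans dp (linkedS sN' py)) andbT.
  by apply: connect_trans dq _; rewrite linked_sym (linkedS sN' xq).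
have nxy d : d = a \/ d = b -> ~~ (linked E' d x && linked E' d y).
  case=> ->; apply: contra nab => /andP[dx dy].
    by apply: connect_trans dy _; rewrite linked_sym.
  by apply: connect_trans ax _; rewrite linked_sym.
apply/graph_treeP; split.
- by rewrite subUset sub1set Ef.
- have hub z : linked (f |: N) x z.
    case: (side z) => [/cN1 | /cN2 yz]; first exact/linkedS/subsetUr.
    apply: connect_trans (linkedS (subsetUr _ _) yz).
    by rewrite linked_edge // -Df setU11.
  by apply/connectedP=> u v; apply: connect_trans (hub v); rewrite linked_sym.
move=> h; rewrite in_setU1; case: (h =P f) => [-> _ | /eqP hf /= Nh].
  apply: contra ncE; apply: connectedS; apply: subset_trans sNE.
  by apply/subsetP=> k; rewrite !inE => /andP[/negPf->].
have Eh := subsetP sNE h Nh.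
have [p [q [_ Dh]]] := edgesP _ _ (subsetP sNe h Nh).
suffices nL : ~~ linked (f |: N :\ [set p; q]) p q.
  apply: contra nL => /connectedP/(_ p q); apply: linkedS; rewrite -Dh.
  by apply/subsetP=> k; rewrite !inE => /andP[-> /=].
(* A tree edge of one side has no end on the other side. *)
have other S C S' C' d d' k : S \subset E' ::&: C -> S' \subset E' ::&: C' ->
    C = [set z | linked E' d z] -> C' = [set z | linked E' d' z] ->
    ~~ linked E' d d' -> k \in S -> k \subset C' -> k \in S'.
- move=> sSC _ DC DC' nd Sk kC'; have [Ek kC] := sS _ _ _ sSC Sk.
  have [u [v [_ Dk]]] := edgesP _ _ (subsetP (subsetDl _ _) k Ek).
  case/negP: nd; move: (subsetP kC u) (subsetP kC' u).
  rewrite Dk set21 DC DC' !inE => /(_ isT) du /(_ isT) d'u.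
  by apply: connect_trans du _; rewrite linked_sym.
move: (Nh); rewrite in_setU => /orP[] Sh; [have [_ hC] := sS _ _ _ sS1 Sh
                                         | have [_ hC] := sS _ _ _ sS2 Sh].
  apply: (bridge A a S1); rewrite -?Dh //; last by apply: nxy; left.
  move=> k; rewrite in_setU => /orP[//|]; apply: (other S2 B S1 A b a) => //.
  by rewrite linked_sym.
apply: (bridge B b S2); rewrite -?Dh //; last by apply: nxy; right.
by move=> k; rewrite in_setU => /orP[|//]; apply: (other S1 A S2 B a b).
Qed.

(** An edge outside N and K cannot connect N, so it runs inside a piece of N
    (linked_sides): deleting K leaves exactly the two pieces of N as components,
    while each single edge of K joins them, whence K is a minimal cut.        *)
Lemma cut_of_trees N (K := [set f in edges e :\: N | graph_tree e (f |: N)]) :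
  2 < #|K| -> exists A B S1 S2, cut_data e K A B S1 S2 /\ N = S1 :|: S2.
Proof.
move=> K3; have [g0 Kg0] : exists g0, g0 \in K.
  by apply/card_gt0P; apply: leq_trans K3.
have := Kg0; rewrite inE => /andP[/setDP[Eg0 Ng0] tg0].
have [sg0 cg0 ming0] := graph_treeP _ tg0.
have Dg0 : (g0 |: N) :\ g0 = N by rewrite setU1K.
have ncN : ~~ connected N by rewrite -Dg0 ming0 ?setU11.
have sNe : N \subset edges e by apply: subset_trans (subsetUr _ _) sg0.
have [a [b [_ Dab]]] := edgesP _ _ Eg0.
set E' := edges e :\: K.
have sNE : N \subset E'.
  by apply/subsetP=> f Nf; rewrite in_setD (subsetP sNe) // inE in_setD Nf.
have LE x y : linked E' x y = linked N x y.
  apply/idP/idP; last exact: linkedS.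
  apply: connect_sub => {}x {}y; rewrite /edge_rel /= in_setD inE in_setD.
  set f := [set x; y]; case Nf: (f \in N) => /=; first by rewrite linked_edge.
  case/andP=> + Ef; rewrite Ef /= => ntf.
  apply: (@linked_sides _ a b); rewrite -?Dab //.
  apply: contra ntf => cf; rewrite -Dg0; apply: tree_exchange; rewrite ?setU11 //.
  by rewrite Dg0.
have nab : ~~ linked N a b.
  apply: contra ncN => ab; apply/connectedP=> x y.
  by rewrite -(linkedU1_id ab) -Dab; apply/connectedP.
have side z : linked E' a z || linked E' b z.
  have /connectedP/(_ a z) := cg0; rewrite Dab linkedU1 !LE.
  by case/or3P=> [->//|/andP[_ ->]|/andP[_ ->]]; rewrite ?orbT.
pose C d := [set z | linked E' d z].
have sp d : component_tree E' (C d) (N ::&: C d).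
  apply/and3P; split.
  - by apply/subsetP=> f; rewrite ![_ \in _ ::&: _]inE => /andP[/(subsetP sNE)->].
  - apply/forall_inP=> x Cx; apply/forall_inP=> y Cy.
    apply: (linked_within (component_closed d sNE)) => //.
    by move: Cx Cy; rewrite !inE !LE linked_sym; apply: connect_trans.
  have /and3P[_ _] := tg0; apply: acyclicS.
  by apply/subsetP=> f; rewrite !inE => /andP[-> _]; rewrite orbT.
exists (C a), (C b), (N ::&: C a), (N ::&: C b); split; [split=> // | ].
- split=> //; apply/minsetP; split.
    apply/andP; split; first by apply/subsetP=> f; rewrite inE => /andP[/setDP[]].
    apply: contra ncN => /connectedP cE; apply/connectedP=> x y.
    by rewrite -LE; apply: cE.
  move=> K' /andP[_ ncK'] sK'; apply/eqP; rewrite eqEsubset sK' /=.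
  apply/subsetP=> f; rewrite inE => /andP[/setDP[Ef _] /graph_treeP[sf cf _]].
  apply: contraR ncK' => K'f; apply: connectedS cf; rewrite subUset sub1set in_setD Ef K'f /=.
  by apply: subset_trans sNE _; apply: setDS.
- split; try by apply/componentsP; eexists.
  by apply: contra nab => /eqP/setP/(_ b); rewrite !inE connect0 LE.
apply/setP=> f; rewrite in_setU ![in RHS]inE -andb_orr.
case Nf: (f \in N) => //=; have [x [y [_ Df]]] := edgesP _ _ (subsetP sNe f Nf).
have sub d : linked E' d x -> f \subset C d.
  move=> dx; rewrite Df subUset !sub1set !inE dx /=; apply: connect_trans dx _.
  by rewrite LE linked_edge -?Df.
by case/orP: (side x) => /sub ->; rewrite ?orbT.
Qed.

End SpanningTrees.
End Connectivity.

(** * Families of sets pairwise related by an exchange *)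

Section ExchangeCliques.

Variable T : finType.
Implicit Types (x y f g : T) (S N U C K : {set T}) (Q : {set {set T}}).

(** As a relation between equicardinal sets this says that S' is S or arises from
    S by one exchange; the families are the cliques of a Johnson graph.       *)
Definition exchange_clique Q : Prop :=
  {in Q &, forall S S', #|S :\: S'| <= 1 /\ #|S| = #|S'|}.

(** Let S1 and S2 be two members, U their union and N their intersection.  A
    member with an element outside U has no other element outside S2, so it misses
    the element of S1 outside S2; it then misses nothing else of S1 and contains N.
    So if some S0 is not inside U, then every member contains
    N: one that misses v in N would lie inside U, and S0 would differ from it both
    by v and by an element outside U.                                         *)
Lemma exchange_clique_types Q : exchange_clique Q -> 1 < #|Q| ->
  (exists U, {in Q, forall S, exists2 g, g \in U & S = U :\ g}) \/
  (exists N, {in Q, forall S, exists2 f, f \notin N & S = f |: N}).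
Proof.
move=> clQ /card_gt1P[S1 [S2 [Q1 Q2 ne12]]].
have one S S' x y : S \in Q -> S' \in Q -> x \in S :\: S' -> y \in S :\: S' -> x = y.
  by move=> QS QS' Sx Sy; have [/card_le1_eqP one _] := clQ S S' QS QS'; apply/esym/one.
have card S : S \in Q -> #|S| = #|S1| by move=> QS; have [_ ->] := clQ S S1 QS Q1.
have diff S S' : S \in Q -> S' \in Q -> S != S' -> exists x, x \in S :\: S'.
  move=> QS QS' neSS'; apply/set0Pn; rewrite setD_eq0; apply: contra neSS' => sSS'.
  by rewrite eqEcard sSS' (card S) // (card S') /=.
have [a D12a] := diff _ _ Q1 Q2 ne12; have /setDP[S1a S2a] := D12a.
have [|b D21b] := diff _ _ Q2 Q1; first by rewrite eq_sym.
have /setDP[S2b S1b] := D21b.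
set U := b |: S1; set N := S1 :\ a.
have cardU : #|U| = #|S1|.+1 by rewrite cardsU1 S1b.
have cardN : #|S1| = #|N|.+1 by rewrite (cardsD1 a) S1a.
have sub2U x : x \in S2 -> x \in U.
  move=> S2x; rewrite in_setU1; case S1x: (x \in S1); rewrite ?orbT // orbF.
  by apply/eqP; apply: (one S2 S1); rewrite // in_setD S1x.
have alt S : S \in Q -> ~~ (S \subset U) -> N \subset S.
  move=> QS /subsetPn[u Su]; rewrite in_setU1 negb_or => /andP[ub S1u].
  have S2u : u \notin S2 by apply: contra (ub) => /sub2U; rewrite in_setU1 (negPf S1u) orbF.
  apply/subsetP=> v /setD1P[va S1v]; apply/negPn/negP=> Sv.
  have Sa : a \in S.
    apply: contraNT va => Sa; apply/eqP; apply: (one S1 S) => //; rewrite in_setD ?Sv ?Sa //.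
  have Dua : u = a by apply: (one S S2) => //; rewrite in_setD ?S2u ?S2a.
  by rewrite Dua S1a in S1u.
have [allU | ] := boolP [forall S in Q, S \subset U].
  left; exists U => S QS; have sSU := forall_inP allU S QS.
  have /set0Pn[g /setDP[Ug Sg]] : U :\: S != set0.
    by rewrite setD_eq0; apply/negP=> /subset_leq_card; rewrite cardU (card S) // ltnn.
  exists g => //; apply/eqP; rewrite eqEcard subsetD1 sSU Sg /= (card S) //.
  by rewrite -ltnS -cardU (cardsD1 g U) Ug.
rewrite negb_forall => /existsP[S0]; rewrite negb_imply => /andP[Q0 nS0].
have sN0 := alt S0 Q0 nS0; right; exists N => S QS.
have sNS : N \subset S.
  apply/negPn/negP=> nNS; have [v Nv Sv] := subsetPn nNS.
  have sSU : S \subset U by apply: contraNT nNS; apply: alt.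
  have [u S0u Uu] := subsetPn nS0.
  have Duv : u = v.
    apply: (one S0 S) => //; rewrite in_setD ?S0u ?(subsetP sN0) ?Sv //.
    by rewrite andbT; apply: contra Uu; apply: (subsetP sSU).
  by case/negP: Uu; rewrite Duv in_setU1; case/setD1P: Nv => _ ->; rewrite orbT.
have /set0Pn[f /setDP[Sf Nf]] : S :\: N != set0.
  rewrite setD_eq0; apply/negP=> /subset_leq_card; by rewrite (card S) // cardN ltnn.
exists f => //; apply/esym/eqP; rewrite eqEcard subUset sub1set Sf sNS /=.
by rewrite (card S) // cardN cardsU1 Nf.
Qed.

(** The first of three members is f |: N.  It contains the elements deleted for the
    other two, and these are not in N, hence both equal f.                    *)
Lemma exchange_types_exclusive Q U N : 2 < #|Q| ->
  {in Q, forall S, exists2 g, g \in U & S = U :\ g} ->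
  {in Q, forall S, exists2 f, f \notin N & S = f |: N} -> False.
Proof.
case/card_gt2P=> S1 [S2 [S3 [[Q1 Q2 Q3] [ne12 ne23 ne31]]]] top bot.
have [g1 U1 D1] := top S1 Q1; have [g2 U2 D2] := top S2 Q2; have [g3 U3 D3] := top S3 Q3.
have [f N1 E1] := bot S1 Q1.
have only g S : S \in Q -> S = U :\ g -> g \in U -> S != S1 -> g = f.
  move=> QS DS Ug neS; have : g \in S1.
    by rewrite D1 in_setD1 Ug andbT; apply: contraNneq neS => Dg; rewrite DS Dg D1.
  rewrite E1 in_setU1 => /orP[/eqP// | Ng]; have [h _ ES] := bot S QS.
  have : g \in S by rewrite ES in_setU1 Ng orbT.
  by rewrite DS setD11.
case/eqP: ne23; rewrite D2 D3 (only g2 S2) 1?eq_sym //.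
by rewrite (only g3 S3).
Qed.

Lemma remove_inj U : {in U &, injective (fun g => U :\ g)}.
Proof.
move=> g h Ug _ /setP/(_ g); rewrite !inE eqxx Ug /=.
by case: (g =P h).
Qed.

Lemma add_inj N f g : f \notin N -> f |: N = g |: N -> f = g.
Proof.
by move=> Nf /setP/(_ f); rewrite !inE eqxx (negPf Nf) orbF; case: (f =P g).
Qed.

Lemma exchange_union_unique U U' g1 g2 h1 h2 : g1 \in U -> g2 \in U -> g1 != g2 ->
  h1 \in U' -> U :\ g1 = U' :\ h1 -> U :\ g2 = U' :\ h2 -> U = U'.
Proof.
move=> U1 U2 ne12 U'1 D1 D2; apply/eqP; rewrite eqEcard.
rewrite (cardsD1 g1 U) (cardsD1 h1 U') D1 U1 U'1 leqnn andbT.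
apply/subsetP=> x Ux; have [Dx | nx] := eqVneq x g1.
  by have /setP/(_ x) := D2; rewrite !inE Ux Dx ne12 => /esym/andP[].
by have /setP/(_ x) := D1; rewrite !inE Ux nx => /esym/andP[].
Qed.

Lemma exchange_inter_unique N N' f1 f2 h1 h2 : f1 \notin N -> f1 != f2 ->
  h1 \notin N' -> f1 |: N = h1 |: N' -> f2 |: N = h2 |: N' -> N = N'.
Proof.
move=> N1 ne12 N'1 D1 D2; apply/esym/eqP; rewrite eqEcard.
have := congr1 (fun S : {set T} => #|S|) D1.
rewrite !cardsU1 N1 N'1 => /addnI ->; rewrite leqnn andbT.
apply/subsetP=> x N'x; have [Dx | nx] := eqVneq x f1.
  by have /setP/(_ x) := D2; rewrite !inE N'x orbT Dx (negPf ne12).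
by have /setP/(_ x) := D1; rewrite !inE N'x orbT (negPf nx) /=.
Qed.

End ExchangeCliques.

(** * Cliques obtained by deleting or adding an edge *)

Section AuxCliques.

Variables (V : finType) (e : rel V).
Hypotheses (e_sym : symmetric e) (e_irr : irreflexive e).
Implicit Types (f g : {set V}) (S N U C K : {set {set V}}) (Q : {set {set {set V}}}).

Lemma aux_clique_exchange Q : aux_clique e Q -> exchange_clique Q.
Proof.
case/andP=> _ /forall_inP clQ S S' QS QS'.
have [<- | neSS'] := eqVneq S S'; first by rewrite setDv cards0.
have /forall_inP/(_ S' QS')/implyP/(_ neSS')/and3P[_ _] := clQ S QS.
case/exists_inP=> f /setDP[_ Sf] /exists_inP[g Sg /eqP->]; split.
  rewrite -(cards1 g); apply/subset_leq_card/subsetP=> h.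
  by rewrite !inE; case: (h =P g) => //= _ /andP[/norP[_ /negPf->]].
have := cardsU1 f S; rewrite (cardsD1 g) setU1r // Sf => /addnI; exact: esym.
Qed.

Lemma remove_clique U C : U \subset edges e -> C \subset U ->
  {in C, forall g, graph_tree e (U :\ g)} -> aux_clique e [set U :\ g | g in C].
Proof.
move=> sU sC tC; apply/andP; split.
  by apply/forall_inP=> _ /imsetP[g Cg ->]; apply: tC.
apply/forall_inP=> _ /imsetP[g Cg ->]; apply/forall_inP=> _ /imsetP[h Ch ->].
apply/implyP=> ne; rewrite /aux_adj !tC //=; have Ug := subsetP sC g Cg.
apply/exists_inP; exists g; first by rewrite !inE eqxx (subsetP sU).
apply/exists_inP; exists h; last by rewrite setD1K.
rewrite in_setD1 (subsetP sC) // andbT.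
by apply: contraNneq ne => ->.
Qed.

Lemma add_clique N K : K \subset edges e :\: N ->
  {in K, forall f, graph_tree e (f |: N)} -> aux_clique e [set f |: N | f in K].
Proof.
move=> sK tK; apply/andP; split.
  by apply/forall_inP=> _ /imsetP[f Kf ->]; apply: tK.
apply/forall_inP=> _ /imsetP[f Kf ->]; apply/forall_inP=> _ /imsetP[h Kh ->].
apply/implyP=> ne; rewrite /aux_adj !tK //=.
have [[Ef Nf] [Eh Nh]] : (f \in edges e /\ f \notin N) /\ (h \in edges e /\ h \notin N).
  by split; apply/setDP; apply: (subsetP sK).
have hf : h != f by apply: contraNneq ne => ->.
apply/exists_inP; exists h; first by rewrite !inE (negPf hf) (negPf Nh).
apply/exists_inP; exists f; first exact: setU11.
by rewrite setUCA setU1K // in_setU1 eq_sym (negPf hf).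
Qed.

Lemma card_remove U C : C \subset U -> #|[set U :\ g | g in C]| = #|C|.
Proof.
by move=> sC; apply: card_in_imset => g h Cg Ch; apply: remove_inj; apply: (subsetP sC).
Qed.

Lemma card_add N K : K \subset edges e :\: N -> #|[set f |: N | f in K]| = #|K|.
Proof.
move=> sK; apply: card_in_imset => f h Kf Kh; apply: add_inj.
by case/setDP: (subsetP sK f Kf).
Qed.

Lemma in_remove U C : C \subset U ->
  {in [set U :\ g | g in C], forall S, exists2 g, g \in U & S = U :\ g}.
Proof. by move=> sC _ /imsetP[g Cg ->]; exists g; rewrite ?(subsetP sC). Qed.

Lemma in_add N K : K \subset edges e :\: N ->
  {in [set f |: N | f in K], forall S, exists2 f, f \notin N & S = f |: N}.
Proof.
by move=> sK _ /imsetP[f Kf ->]; exists f => //; case/setDP: (subsetP sK f Kf).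
Qed.

(** A larger clique cannot be of the other type, as three of its members already
    have this one; and its set U is determined by two members.                *)
Lemma remove_max U C : U \subset edges e -> C \subset U -> 2 < #|C| ->
    {in U, forall g, graph_tree e (U :\ g) = (g \in C)} ->
  max_aux_clique e [set U :\ g | g in C].
Proof.
move=> sU sC C3 tU; apply/maxsetP; split.
  by apply: remove_clique => // g Cg; rewrite tU ?(subsetP sC).
move=> Q clQ sQ; apply/eqP; rewrite eqEsubset sQ andbT.
have Q1 : 1 < #|Q| by rewrite (leq_trans (ltnW C3)) // -(card_remove sC) subset_leq_card.
case: (exchange_clique_types (aux_clique_exchange clQ) Q1) => [[U' top] | [N bot]]; last first.
  case: (@exchange_types_exclusive _ [set U :\ g | g in C] U N).
  - by rewrite card_remove.
  - exact: in_remove.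
  by move=> S /(subsetP sQ)/bot.
have /card_gt1P[c1 [c2 [C1 C2 ne12]]] := ltnW C3.
have [h1 U1 D1] := top _ (subsetP sQ _ (imset_f _ C1)).
have [h2 U2 D2] := top _ (subsetP sQ _ (imset_f _ C2)).
have DU : U = U'.
  by apply: exchange_union_unique ne12 U1 D1 D2; apply: (subsetP sC).
apply/subsetP=> S QS; have [g Ug DS] := top S QS; rewrite -DU in Ug DS.
have /andP[/forall_inP/(_ S QS) + _] := clQ.
by rewrite DS tU // => Cg; apply: imset_f.
Qed.

(** The dual argument, with N in place of U. *)
Lemma add_max N K : K \subset edges e :\: N -> 2 < #|K| ->
    {in edges e :\: N, forall f, graph_tree e (f |: N) = (f \in K)} ->
  max_aux_clique e [set f |: N | f in K].
Proof.
move=> sK K3 tN; apply/maxsetP; split.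
  by apply: add_clique => // f Kf; rewrite tN ?(subsetP sK).
move=> Q clQ sQ; apply/eqP; rewrite eqEsubset sQ andbT.
have Q1 : 1 < #|Q| by rewrite (leq_trans (ltnW K3)) // -(card_add sK) subset_leq_card.
case: (exchange_clique_types (aux_clique_exchange clQ) Q1) => [[U top] | [N' bot]].
  case: (@exchange_types_exclusive _ [set f |: N | f in K] U N).
  - by rewrite card_add.
  - by move=> S /(subsetP sQ)/top.
  exact: in_add.
have /card_gt1P[f1 [f2 [K1 K2 ne12]]] := ltnW K3.
have [h1 N1 D1] := bot _ (subsetP sQ _ (imset_f _ K1)).
have [h2 N2 D2] := bot _ (subsetP sQ _ (imset_f _ K2)).
have DN : N = N'.
  by apply: exchange_inter_unique ne12 N1 D1 D2; case/setDP: (subsetP sK f1 K1).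
apply/subsetP=> S QS; have [f Nf DS] := bot S QS; rewrite -DN in Nf DS.
have /andP[/forall_inP/(_ S QS) tS _] := clQ.
have Ef : f \in edges e :\: N.
  rewrite in_setD Nf; have /and3P[/subsetP-> //] := tS.
  by rewrite DS setU11.
by apply/imsetP; exists f; rewrite // -tN -?DS.
Qed.

(** * The cliques of a cycle *)

Lemma cycle_familyE (c : seq V) S : 2 < size c -> uniq c ->
  cycle_family c S = [set (S :|: cycle_edges c) :\ g | g in cycle_edges c].
Proof.
move=> szc Uc; have cardC := card_cycle_edges szc Uc; rewrite /cycle_family.
set C := cycle_edges c in cardC *.
apply/setP=> X; apply/imsetP/imsetP=> [[D] | [g Cg ->]].
  rewrite inE => /andP[sD /eqP cardD] ->.
  have /cards1P[g Dg] : #|C :\: D| == 1.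
    rewrite cardsD (setIidPr sD) cardD cardC.
    by case: (size c) szc => // n _; rewrite subSnn.
  exists g; first by have /setDP[] : g \in C :\: D by rewrite Dg set11.
  apply/setP=> h; have /setP/(_ h) := Dg; rewrite !inE => <-.
  have := subsetP sD h; case: (h \in D) => [->|_]; rewrite ?orbT //.
  by case: (h \in C); rewrite ?orbF.
exists (C :\ g).
  by rewrite inE subsetDl -cardC (cardsD1 g C) Cg /=.
apply/setP=> h; rewrite !inE; case: eqP => [->|]; rewrite ?Cg //=.
by case: (h \in C); rewrite ?orbT ?orbF.
Qed.

Lemma cycle_data_missing (c : seq V) S : cycle_data e c S ->
  exists2 g, g \in cycle_edges c & S = (S :|: cycle_edges c) :\ g.
Proof.
case; rewrite is_cycle_graph // => /and3P[szc Uc sc] _ cardSC.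
have /cards1P[g Dg] : #|cycle_edges c :\: S| == 1.
  rewrite cardsD setIC cardSC card_cycle_edges //.
  by case: (size c) szc => // n _; rewrite subSnn.
exists g.
  by have /setDP[] : g \in cycle_edges c :\: S by rewrite Dg set11.
apply/setP=> h; have /setP/(_ h) := Dg; rewrite !inE => <-.
by case: (h \in S); case: (h \in cycle_edges c).
Qed.

Lemma cycle_family_max (c : seq V) S : cycle_data e c S ->
  max_aux_clique e (cycle_family c S) /\ #|cycle_family c S| = size c.
Proof.
move=> dat; have [g0 Cg0 DS] := cycle_data_missing dat.
case: dat => cyc tS _; move: cyc; rewrite is_cycle_graph // => /and3P[szc Uc sc].
have cardC := card_cycle_edges szc Uc; rewrite cycle_familyE //.
set U := S :|: _ in DS *; have sCU : cycle_edges c \subset U by apply: subsetUr.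
rewrite card_remove // cardC; split=> //; apply: remove_max; rewrite ?cardC //.
  by rewrite subUset sc andbT; case/and3P: tS.
apply: (@cycle_trees _ _ e_sym e_irr _ _ g0); rewrite -?DS ?(subsetP sCU) //.
  by rewrite subUset sc andbT; case/and3P: tS.
by rewrite is_cycleE szc Uc.
Qed.

(** * The cliques of a cut *)

Lemma cut_family_max K (A B : {set V}) S1 S2 : cut_data e K A B S1 S2 ->
  max_aux_clique e (cut_family K S1 S2) /\ #|cut_family K S1 S2| = #|K|.
Proof.
move=> dat; have [sK tN] := cut_trees e_sym e_irr dat; case: dat => -[_ K3] _ _ _.
by split; [apply: add_max | apply: card_add].
Qed.

(** * Recognizing a maximal clique *)

(** Any tree of Q misses one edge of U, so U is connected without being minimal
    and has a cycle; the deleted edges all lie on it.                        *)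
Lemma remove_cycle_form Q U : max_aux_clique e Q -> 2 < #|Q| ->
  {in Q, forall S, exists2 g, g \in U & S = U :\ g} -> cycle_form e Q.
Proof.
case/maxsetP=> clQ maxQ Q3 top; have /andP[/forall_inP tQ _] := clQ.
have /card_gt2P[S1 [S2 [S3 [[Q1 Q2 _] [ne12 _ _]]]]] := Q3.
have [g1 U1 D1] := top S1 Q1; have [g2 U2 D2] := top S2 Q2.
have t1 := tQ S1 Q1; have t2 := tQ S2 Q2.
have [sE1 c1 _] := graph_treeP e_sym e_irr _ t1.
have [sE2 _ _] := graph_treeP e_sym e_irr _ t2.
have ne_g : g2 != g1 by apply: contraNneq ne12 => Dg; rewrite D1 D2 Dg.
have sU : U \subset edges e.
  rewrite -(setD1K U1) -D1 subUset sE1 sub1set andbT (subsetP sE2) //.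
  by rewrite D2 in_setD1 eq_sym ne_g.
have [c] : exists c, is_cycle (edge_rel U) c.
  have : ~~ acyclic U.
    apply/negP=> acU; have : graph_tree e U.
      by rewrite /graph_tree /spanning_tree sU acU (connectedS _ c1) // D1 subsetDl.
    by case/(graph_treeP e_sym e_irr)=> _ _ /(_ g1 U1); rewrite -D1 c1.
  rewrite negb_forall => /existsP[n].
  by rewrite negb_forall => /existsP[c /negPn cyc]; exists c.
move=> cyc; have tU := cycle_trees e_sym e_irr sU cyc U1; rewrite -D1 in tU.
have {}tU := tU t1.
move: cyc; rewrite is_cycleE => /and3P[szc Uc cU]; set C := cycle_edges c in cU tU.
have C1 : g1 \in C by rewrite -tU // -D1.
have DU : S1 :|: C = U.
  apply/setP=> h; rewrite D1 !inE; have := subsetP cU h.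
  case: (h =P g1) => [->|_] /=; first by rewrite C1 U1.
  by case: (h \in C) => [->//|]; rewrite ?orbT ?orbF.
exists c, S1; split.
  split=> //; first by rewrite is_cycle_graph // szc Uc (subset_trans cU).
  have -> : S1 :&: C = C :\ g1.
    by rewrite D1 setIDAC (setIidPr cU).
  by rewrite -(card_cycle_edges szc Uc) -/C (cardsD1 g1 C) C1.
rewrite cycle_familyE // -/C DU; apply/esym/maxQ.
  by apply: remove_clique => // g Cg; rewrite tU // (subsetP cU).
apply/subsetP=> S QS; have [g Ug DS] := top S QS.
by apply/imsetP; exists g; rewrite // -tU // -DS tQ.
Qed.

(** Q lies in the clique of all the trees that arise from N by adding an edge, and
    that clique is the one of a cut.                                          *)
Lemma add_cut_form Q N : max_aux_clique e Q -> 2 < #|Q| ->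
  {in Q, forall S, exists2 f, f \notin N & S = f |: N} -> cut_form e Q.
Proof.
case/maxsetP=> clQ maxQ Q3 bot; have /andP[/forall_inP tQ _] := clQ.
set K := [set f in edges e :\: N | graph_tree e (f |: N)].
have sK : K \subset edges e :\: N by apply/subsetP=> f; rewrite inE => /andP[].
have sQ : Q \subset [set f |: N | f in K].
  apply/subsetP=> S QS; have [f Nf DS] := bot S QS; have tS := tQ S QS.
  apply/imsetP; exists f; rewrite // inE in_setD Nf -DS tS andbT.
  by have /and3P[/subsetP-> //] := tS; rewrite DS setU11.
have K3 : 2 < #|K| by rewrite -(card_add sK) (leq_trans Q3) ?subset_leq_card.
have [A [B [S1 [S2 [dat DN]]]]] := cut_of_trees e_sym e_irr K3.
exists K, A, B, S1, S2; split=> //; rewrite /cut_family -DN; apply/esym/maxQ => //.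
by apply: add_clique => // f; rewrite inE => /andP[].
Qed.

Lemma cycle_cut_exclusive Q : 2 < #|Q| -> cycle_form e Q -> cut_form e Q -> False.
Proof.
move=> Q3 [c [S [[cyc _ _] DQ]]] [K [A [B [S1 [S2 [dat EQ]]]]]].
move: cyc; rewrite is_cycle_graph // => /and3P[szc Uc _].
have [sK _] := cut_trees e_sym e_irr dat.
apply: (exchange_types_exclusive Q3).
  by rewrite DQ cycle_familyE //; apply/in_remove/subsetUr.
by rewrite EQ; apply: in_add.
Qed.

End AuxCliques.

Theorem mainTheorem6 (V : finType) (e : rel V)
    (e_sym : symmetric e) (e_irr : irreflexive e)
    (e_conn : forall x y : V, connect e x y) :
  [/\ (forall (c : seq V) (S : {set {set V}}),
         cycle_data e c S ->
         max_aux_clique e (cycle_family c S) /\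
         #|cycle_family c S| = size c),
      (forall (K : {set {set V}}) (A B : {set V}) (S1 S2 : {set {set V}}),
         cut_data e K A B S1 S2 ->
         max_aux_clique e (cut_family K S1 S2) /\
         #|cut_family K S1 S2| = #|K|)
    & (forall Q : {set {set {set V}}},
         max_aux_clique e Q -> 3 <= #|Q| ->
         (cycle_form e Q \/ cut_form e Q) /\
         ~ (cycle_form e Q /\ cut_form e Q))].
Proof.
split=> [c S | K A B S1 S2 | Q maxQ Q3].
- exact: cycle_family_max.
- exact: cut_family_max.
split; last by case; apply: cycle_cut_exclusive.
have /maxsetP[/aux_clique_exchange clQ _] := maxQ.
case: (exchange_clique_types clQ (ltnW Q3)) => [[U top] | [N bot]].
  by left; apply: remove_cycle_form top.
by right; apply: add_cut_form bot.
Qed.
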